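(* Let $X$ be a real Banach space and let $G\subseteq\mathcal{L}(X)$ be a compact topological group of isometries acting on $X$. If $C\subseteq X$ is a nonempty, convex, closed, bounded and $G$-invariant subset, then the set of functionals in $X^*_G$ that attain their maximum on $C$, that is, of those $h\in X^*_G$ for which there is $x_0\in C$ with $h(x_0)=\sup_{x\in C}h(x)$, is dense in $X^*_G$.
   Context: $\mathcal{L}(X)$ is the space of continuous linear maps $X\to X$ with the operator norm topology; $G\subseteq \mathcal{L}(X)$ is a group (under composition) of invertible bounded linear maps with the relative topology. A set $C\subseteq X$ is $G$-invariant if $g(C)=C$ for every $g\in G$. A functional $f$ is $G$-invariant if $f(g(x))=f(x)$ for all $x\in X$, $g\in G$; $X^*_G$ is the set of $G$-invariant elements of $X^*$, with the dual norm. *)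

(* Defs.v *)
(* MathComp-Analysis *)
From HB Require Import structures.
From mathcomp Require Import all_boot all_order all_algebra.
From mathcomp Require Import all_classical all_reals all_analysis.

Set Implicit Arguments.
Unset Strict Implicit.
Unset Printing Implicit Defensive.

Import Order.TTheory GRing.Theory Num.Theory.
Import numFieldNormedType.Exports.

Local Open Scope classical_set_scope.
Local Open Scope ring_scope.

HB.structure Definition LinearContinuous (R : realType)
    (E F : normedModType R) :=
  {f of @GRing.Linear R E F *:%R f & @isContinuous E F f}.

Notation "{ 'lcfun' E >-> F }" := (@LinearContinuous.type _ E F)
  (at level 0, format "{ 'lcfun'  E  >->  F }") : type_scope.
Notation "[ 'lcfun' 'of' f ]" := [the {lcfun _ >-> _} of f]
  (at level 0, format "[ 'lcfun'  'of'  f ]") : form_scope.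

Section lcfun_lmodType.
Context {R : realType} {E F : normedModType R}.
Implicit Types f g : {lcfun E >-> F}.

Definition lcfun : {pred E -> F} :=
  mem [set f | linear f /\ continuous f].
Definition lcfun_key : pred_key lcfun. Proof. exact. Qed.
Canonical lcfun_keyed := KeyedPred lcfun_key.

Section Sub.
Variables (f : E -> F) (fP : f \in lcfun).

Let lcfun_Sub_linear := GRing.isLinear.Build R E F *:%R f (set_mem fP).1.
Let lcfun_Sub_continuous := isContinuous.Build E F f (set_mem fP).2.
#[local] HB.instance Definition _ := lcfun_Sub_linear.
#[local] HB.instance Definition _ := lcfun_Sub_continuous.
Definition lcfun_Sub : {lcfun E >-> F} := [lcfun of f].
End Sub.

Lemma lcfun_linearP f : linear f.
Proof. exact: linearP. Qed.

Lemma lcfun_continuous f : continuous f.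
Proof. exact: cts_fun. Qed.

Lemma lcfun_in f : (f : E -> F) \in lcfun.
Proof.
by apply/mem_set; split; [exact: lcfun_linearP|exact: lcfun_continuous].
Qed.

Lemma lcfun_ext f g : (f : E -> F) = g -> f = g.
Proof.
case: f g => f [[fa] [fl] [fc]] [g [[ga] [gl] [gc]]] /= fg.
case: g / fg ga gl gc => ga gl gc.
by rewrite (Prop_irrelevance fa ga) (Prop_irrelevance fl gl)
  (Prop_irrelevance fc gc).
Qed.

Lemma lcfun_rect (K : {lcfun E >-> F} -> Type) :
  (forall (h : E -> F) (Pf : h \in lcfun), K (lcfun_Sub Pf)) ->
  forall u : {lcfun E >-> F}, K u.
Proof.
move=> Ksub u.
by rewrite (_ : u = lcfun_Sub (lcfun_in u)); [exact: Ksub|exact: lcfun_ext].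
Qed.

Lemma lcfun_valP (h : E -> F) (Pf : h \in lcfun) : lcfun_Sub Pf = h :> (_ -> _).
Proof. by []. Qed.

HB.instance Definition _ := isSub.Build _ _ {lcfun E >-> F} lcfun_rect lcfun_valP.
HB.instance Definition _ := [Choice of {lcfun E >-> F} by <:].

Lemma lcfunP f g : f = g <-> f =1 g.
Proof. by split=> [->//|fg]; apply/lcfun_ext/funext. Qed.

Lemma lcfun_submod_closed : submod_closed lcfun.
Proof.
split=> [|a f g]; rewrite !inE /=.
  split=> [k x y|x]; first by rewrite scaler0 addr0.
  exact: cvg_cst.
move=> [fl fc] [gl gc]; split=> [k x y|x].
  rewrite [LHS](_ : _ = a *: f (k *: x + y) + g (k *: x + y))//.
  rewrite [in RHS](_ : (a *: f + g) x = a *: f x + g x)//.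
  rewrite [in RHS](_ : (a *: f + g) y = a *: f y + g y)//.
  by rewrite fl gl !scalerDr !scalerA mulrC addrACA.
by apply: cvgD; [apply: cvgZr; exact: fc|exact: gc].
Qed.

HB.instance Definition _ :=
  GRing.isSubmodClosed.Build R (E -> F) lcfun lcfun_submod_closed.
HB.instance Definition _ :=
  [SubChoice_isSubLmodule of {lcfun E >-> F} by <:].

Lemma lcfun_addE f g x : (f + g) x = f x + g x. Proof. by []. Qed.
Lemma lcfun_scaleE a f x : (a *: f) x = a *: f x. Proof. by []. Qed.
Lemma lcfun_zeroE x : (0 : {lcfun E >-> F}) x = 0. Proof. by []. Qed.

End lcfun_lmodType.

Section lcfun_id_comp.
Context {R : realType} {E F H : normedModType R}.

HB.instance Definition _ := Continuous.on (@idfun E).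

Variables (f : {lcfun E >-> F}) (g : {lcfun F >-> H}).
HB.instance Definition _ := Continuous.on (g \o f).
End lcfun_id_comp.

Section opnorm.
Context {R : realType} {E F : normedModType R}.
Implicit Types f g : {lcfun E >-> F}.

Definition opnorm f : R := sup [set `|f x| | x in [set x : E | `|x| <= 1]].

Lemma opnorm_has_sup f :
  has_sup [set `|f x| | x in [set x : E | `|x| <= 1]].
Proof.
split; first by exists `|f 0|, 0; rewrite //= normr0.
have [_ /(_ (continuous_linear_bounded 0 (@lcfun_continuous _ _ _ f 0)))] :=
  bounded_funP f.
by move=> /(_ 1)[M fM]; exists M => _ /= [x x1 <-]; exact: fM.
Qed.

Lemma opnorm_ge0 f : 0 <= opnorm f.
Proof.
apply: (@le_trans _ _ `|f 0|); first exact: normr_ge0.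
apply: sup_upper_bound; first exact: opnorm_has_sup.
by exists 0; rewrite //= normr0.
Qed.

Lemma opnorm_le f x : `|f x| <= opnorm f * `|x|.
Proof.
have [->|x0] := eqVneq x 0; first by rewrite linear0 !normr0 mulr0.
have nx0 : 0 < `|x| by rewrite normr_gt0.
rewrite -ler_pdivrMr// mulrC.
rewrite -[in `|x|^-1](@normr_id _ _ x) -normfV -normrZ -linearZ.
apply: sup_upper_bound; first exact: opnorm_has_sup.
by exists (`|x|^-1 *: x) => //=; rewrite normrZ normfV normr_id mulVf ?gt_eqF.
Qed.

Lemma opnorm_lub f (M : R) : 0 <= M -> (forall x, `|f x| <= M * `|x|) ->
  opnorm f <= M.
Proof.
move=> M0 fM; apply: ge_sup; first by have [] := opnorm_has_sup f.
by move=> _ [x /= x1 <-]; rewrite (le_trans (fM x))// ler_piMr.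
Qed.

Lemma opnormD f g : opnorm (f + g) <= opnorm f + opnorm g.
Proof.
apply: opnorm_lub => [|x]; first by rewrite addr_ge0// opnorm_ge0.
by rewrite mulrDl (le_trans (ler_normD _ _))// lerD// opnorm_le.
Qed.

Lemma opnormZ (a : R) f : opnorm (a *: f) = `|a| * opnorm f.
Proof.
have leZ b g : opnorm (b *: g) <= `|b| * opnorm g.
  apply: opnorm_lub => [|x]; first by rewrite mulr_ge0// opnorm_ge0.
  by rewrite lcfun_scaleE normrZ -mulrA ler_wpM2l// opnorm_le.
apply/eqP; rewrite eq_le leZ/=.
have [->|a0] := eqVneq a 0; first by rewrite normr0 mul0r opnorm_ge0.
rewrite -ler_pdivlMl ?normr_gt0//.
by rewrite -{1}[f](scalerK a0) -normfV leZ.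
Qed.

Lemma opnorm_eq0 f : opnorm f = 0 -> f = 0.
Proof.
move=> f0; apply/lcfunP => x; apply/eqP.
by rewrite -normr_le0 (le_trans (opnorm_le f x))// f0 mul0r.
Qed.

HB.instance Definition _ :=
  Lmodule_isNormed.Build R {lcfun E >-> F} opnormD opnormZ opnorm_eq0.

Lemma lcfun_normE f : `|f| = opnorm f. Proof. by []. Qed.

End opnorm.

Lemma lcfun_norm_comp {R : realType} {E F H : normedModType R}
    (f : {lcfun E >-> F}) (g : {lcfun F >-> H}) :
  `|[lcfun of g \o f]| <= `|g| * `|f|.
Proof.
apply: opnorm_lub => [|x]; first by rewrite mulr_ge0.
rewrite (le_trans (opnorm_le g (f x)))// -mulrA ler_wpM2l//;
  [exact: opnorm_ge0|exact: opnorm_le].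
Qed.

Section groups_of_operators.
Context {R : realType} {X : normedModType R}.
Implicit Types (G : set {lcfun X >-> X}) (C : set X).

(* Purely algebraic: by [lcfun_norm_comp], composition is jointly continuous
   for the operator norm, and so is inversion on invertible operators, hence
   such a [G] is automatically a topological group for the relative topology. *)
Definition operator_group G :=
  [/\ G [lcfun of @idfun X],
      forall g h, G g -> G h -> G [lcfun of g \o h] &
      forall g, G g -> exists h, [/\ G h,
        [lcfun of g \o h] = [lcfun of @idfun X] &
        [lcfun of h \o g] = [lcfun of @idfun X]]].

Definition isometries G :=
  forall g, G g -> forall x y, `|g x - g y| = `|x - y|.

Definition invariant_set G C := forall g, G g -> g @` C = C.

Definition invariant_dual G : set {lcfun X >-> R^o} :=
  [set f | forall g x, G g -> f (g x) = f x].

(* [sup] is the supremum of a set of reals (0 when the set is empty or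
   unbounded above); for [C] nonempty and bounded it is the true supremum. *)
Definition attains_max C (h : {lcfun X >-> R^o}) :=
  exists2 x0, C x0 & h x0 = sup (h @` C).

End groups_of_operators.

(* Main.v *)
(* Averaging over [G] gives a contractive projection [P] onto the fixed points of
   [G] with [P g = P] for [g] in [G], mapping [C] into itself. By the
   Bishop-Phelps theorem for [C] intersected with the fixed points, a given
   invariant [f] is close to some [psi] attaining its maximum there at [x0];
   then [psi \o P] is invariant, close to [f \o P = f], and attains its maximum
   on [C] at [x0].

   No Haar measure is needed: [P] is a pointwise limit of operators [A n] in the
   midpoint-convex hull of [G] whose two-sided orbits under [G] have diameter
   tending to [0]. *)
Require Import Defs.
From mathcomp Require Import all_boot all_order all_algebra.
From mathcomp Require Import all_classical all_reals all_analysis.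
From mathcomp Require Import lra ring.

Set Implicit Arguments.
Unset Strict Implicit.
Unset Printing Implicit Defensive.

Import Order.TTheory GRing.Theory Num.Theory.
Import numFieldNormedType.Exports.

Local Open Scope classical_set_scope.
Local Open Scope ring_scope.

(** * The Hahn-Banach theorem, with a cone of lower constraints *)

Definition sublinear (R : realType) (V : lmodType R) (p : V -> R) :=
  (forall x y, p (x + y) <= p x + p y) /\
  (forall (t : R) x, 0 <= t -> p (t *: x) = t * p x).

Section cone_envelope.
Context {R : realType} {V : lmodType R} (p : V -> R) (S : set (V * R)).

(* The largest sublinear functional below [p] with value at most [- a] at
   [- c] for every [(c, a)] in [S]. *)
Definition cone_envelope (x : V) : R :=
  inf [set p (x + c.1) - c.2 | c in S].

Hypotheses (p_sub : sublinear p) (S0 : S (0, 0))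
  (SD : forall c d, S c -> S d -> S (c + d))
  (SZ : forall (t : R) c, 0 <= t -> S c -> S (t *: c))
  (Sp : forall c, S c -> c.2 <= p c.1).

Let has_lb x : has_lbound [set p (x + c.1) - c.2 | c in S].
Proof.
exists (- p (- x)) => _ [c Sc <-].
have := p_sub.1 (x + c.1) (- x); rewrite addrAC subrr add0r.
by move: (Sp Sc); lra.
Qed.

Lemma cone_envelope_le c x : S c -> cone_envelope x <= p (x + c.1) - c.2.
Proof. by move=> Sc; apply: ge_inf => //; exists c. Qed.

Lemma cone_envelope_lep x : cone_envelope x <= p x.
Proof. by have := cone_envelope_le x S0; rewrite addr0 subr0. Qed.

Lemma cone_envelopeN c : S c -> cone_envelope (- c.1) <= - c.2.
Proof.
move=> Sc; have := cone_envelope_le (- c.1) Sc.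
by rewrite addNr -(scale0r c.1) p_sub.2// mul0r sub0r.
Qed.

Let envelope_ge (y : R) x : (forall c, S c -> y <= p (x + c.1) - c.2) ->
  y <= cone_envelope x.
Proof.
move=> yS; apply: lb_le_inf; first by exists (p (x + 0) - 0), (0, 0).
by move=> _ [c Sc <-]; exact: yS.
Qed.

(** Subadditivity comes from adding constraints, homogeneity from rescaling them; for [t > 0] the
    reverse inequality is [leZ] at [t^-1]. *)
Lemma cone_envelope_sublinear : sublinear cone_envelope.
Proof.
have [pD pZ] := p_sub.
have leZ (t : R) x : 0 < t -> cone_envelope (t *: x) <= t * cone_envelope x.
  move=> t0; rewrite -ler_pdivrMl//; apply: (envelope_ge) => c Sc.
  rewrite ler_pdivrMl//.
  have := cone_envelope_le (t *: x) (SZ (ltW t0) Sc).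
  by rewrite -scalerDr /= (pZ _ _ (ltW t0)) mulrBr.
split=> [x y|t x].
  rewrite -lerBlDr; apply: (envelope_ge) => c Sc.
  rewrite lerBlDr -lerBlDl; apply: (envelope_ge) => d Sd.
  have := cone_envelope_le (x + y) (SD Sc Sd).
  by have := pD (x + c.1) (y + d.1); rewrite addrACA /=; lra.
rewrite le_eqVlt => /predU1P[<-|t0].
  rewrite scale0r mul0r; apply/eqP; rewrite eq_le; apply/andP; split.
    by rewrite (le_trans (cone_envelope_lep _))// -(scale0r 0) pZ// mul0r.
  by apply: (envelope_ge) => c Sc; rewrite add0r subr_ge0 Sp.
apply/eqP; rewrite eq_le leZ//= -ler_pdivlMl//.
by have := leZ t^-1 (t *: x); rewrite scalerA mulVf ?gt_eqF// scale1r invr_gt0; apply.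
Qed.

End cone_envelope.

Section hahn_banach.
Context {R : realType} {V : lmodType R}.
Implicit Types p q : V -> R.

(* A minimal sublinear functional is odd: otherwise its envelope along a ray
   would be strictly smaller. *)
Lemma minimal_sublinear_linear q : sublinear q ->
  (forall r, sublinear r -> (forall x, r x <= q x) -> r = q) ->
  linear (q : V -> R^o).
Proof.
move=> q_sub q_min; have [qD qZ] := q_sub.
have qN y : q (- y) = - q y.
  pose S := [set (t *: y, t * q y) | t in [set t | 0 <= t]].
  have S0 : S (0, 0) by exists 0 => //=; rewrite scale0r mul0r.
  have SD c d : S c -> S d -> S (c + d).
    move=> [s s0 <-] [t t0 <-]; exists (s + t); first exact: addr_ge0.
    by rewrite scalerDl mulrDl.
  have SZ (t : R) c : 0 <= t -> S c -> S (t *: c).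
    move=> t0 [s s0 <-]; exists (t * s); first exact: mulr_ge0.
    by rewrite -scalerA -mulrA.
  have Sq c : S c -> c.2 <= q c.1 by move=> [t t0 <-] /=; rewrite qZ.
  have Sy : S (y, q y) by exists 1; rewrite /= ?scale1r ?mul1r.
  have eq_q : cone_envelope q S = q.
    apply: q_min => [|x]; first exact: cone_envelope_sublinear.
    exact: cone_envelope_lep.
  have := cone_envelopeN q_sub Sq Sy; rewrite eq_q /=.
  have := qD y (- y); rewrite subrr -(scale0r 0) qZ// mul0r.
  by move=> *; apply/eqP; rewrite eq_le; apply/andP; split; lra.
have qA x y : q (x + y) = q x + q y.
  apply/eqP; rewrite eq_le qD/=.
  by have := qD (x + y) (- y); rewrite addrK qN; lra.
have qZr (t : R) x : q (t *: x) = t * q x.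
  have [t0|t0] := leP 0 t; first exact: qZ.
  by rewrite -[t]opprK scaleNr qN qZ ?mulNr// oppr_ge0 ltW.
by move=> t x y; rewrite qA qZr.
Qed.

Lemma sublinear_lb p q x : sublinear q -> (forall y, q y <= p y) ->
  - p (- x) <= q x.
Proof.
move=> [qD qZ] qp; have := qD x (- x); rewrite subrr -(scale0r 0) qZ// mul0r.
by have := qp (- x); lra.
Qed.

(** Zorn's lemma yields a minimal sublinear functional below [p], and such a functional is
    linear. *)
Lemma hahn_banach_sublinear p : sublinear p ->
  exists2 f : V -> R^o, linear f & forall x, f x <= p x.
Proof.
move=> p_sub.
pose T := {q | sublinear q /\ forall x, q x <= p x}.
(* Reversed, so that a maximal element for [le] is a minimal functional. *)
pose le (q r : T) := `[< forall x, sval r x <= sval q x >].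
have [||||[q [q_sub qp]] q_min] := @Zorn T le.
- by move=> q; apply/asboolP.
- by move=> q r s /asboolP qr /asboolP rs; apply/asboolP => x; exact: le_trans (qr x).
- move=> [q hq] [r hr] /asboolP /= rq /asboolP /= qr.
  have qr_eq : q = r by apply/funext => x; apply/eqP; rewrite eq_le rq qr.
  by rewrite -qr_eq in hr *; congr exist; exact: Prop_irrelevance.
- move=> A totA.
  (* The empty chain is bounded by [p] itself, a nonempty one by its pointwise infimum, which is
     finite by [sublinear_lb]. *)
  have [[q0 Aq0]|A0] := pselect (A !=set0); last first.
    by exists (exist _ p (conj p_sub (fun=> lexx _))) => q Aq; case: A0; exists q.
  pose r x := inf [set sval q x | q in A].
  have lbA x : has_lbound [set sval q x | q in A].
    exists (- p (- x)) => _ [q Aq <-].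
    exact: sublinear_lb (svalP q).1 (svalP q).2.
  have r_le (s : T) x : A s -> r x <= sval s x by move=> As; apply: ge_inf => //; exists s.
  have r_ge (y : R) x : (forall s, A s -> y <= sval s x) -> y <= r x.
    move=> yA; apply: lb_le_inf; first by exists (sval q0 x), q0.
    by move=> _ [q Aq <-]; exact: yA.
  have rleZ (t : R) x : 0 < t -> r (t *: x) <= t * r x.
    move=> t0; rewrite -ler_pdivrMl//; apply: (r_ge) => q Aq.
    by rewrite ler_pdivrMl// -(svalP q).1.2 ?(ltW t0)// r_le.
  suff hr : sublinear r /\ forall x, r x <= p x.
    by exists (exist _ r hr) => q Aq; apply/asboolP => x; exact: r_le.
  split; last by move=> x; exact: le_trans (r_le q0 x Aq0) ((svalP q0).2 x).
  split=> [x y|t x].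
    rewrite -lerBlDr; apply: (r_ge) => q Aq.
    rewrite lerBlDr -lerBlDl; apply: (r_ge) => s As.
    (* Of two members of a chain one is the smaller, and its subadditivity serves for both. *)
    case: (totA q s Aq As) => /asboolP qs.
      by have := r_le s (x + y) As; have := (svalP s).1.1 x y; have := qs x; lra.
    by have := r_le q (x + y) Aq; have := (svalP q).1.1 x y; have := qs y; lra.
  rewrite le_eqVlt => /predU1P[<-|t0].
    have q00 (q : T) : sval q 0 = 0.
      by rewrite -(scale0r 0) (svalP q).1.2// mul0r.
    rewrite scale0r mul0r; apply/eqP; rewrite eq_le; apply/andP; split.
      by rewrite -(q00 q0) r_le.
    by apply: (r_ge) => q _; rewrite q00.
  apply/eqP; rewrite eq_le rleZ//= -ler_pdivlMl//.
  have := rleZ t^-1 (t *: x); rewrite scalerA mulVf ?gt_eqF// scale1r invr_gt0.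
  exact.
exists q => //; apply: minimal_sublinear_linear => // r r_sub rq.
have hr : sublinear r /\ forall x, r x <= p x.
  by split=> // x; exact: le_trans (rq x) (qp x).
by have [] := congr1 sval (q_min (exist _ r hr) (asboolT rq)).
Qed.

(** A linear functional below the cone envelope is at most [- c.2] at [- c.1]; oddness turns this
    into the lower bound at [c.1]. *)
Lemma hahn_banach_cone p (S : set (V * R)) : sublinear p -> S (0, 0) ->
  (forall c d, S c -> S d -> S (c + d)) ->
  (forall (t : R) c, 0 <= t -> S c -> S (t *: c)) ->
  (forall c, S c -> c.2 <= p c.1) ->
  exists f : V -> R^o, [/\ linear f, forall x, f x <= p x &
    forall c, S c -> c.2 <= f c.1].
Proof.
move=> p_sub S0 SD SZ Sp.
have [f fl fp] := hahn_banach_sublinear (cone_envelope_sublinear p_sub S0 SD SZ Sp).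
exists f; split=> // [x|c Sc].
  exact: le_trans (fp x) (cone_envelope_lep _ _ _ _).
have fN : f (- c.1) = - f c.1.
  have := fl (-1) 0 0; rewrite scaler0 addr0 => f0.
  have {}f0 : f 0 = 0 by move: f0; rewrite scaleN1r => ->; rewrite addNr.
  by have := fl (-1) c.1 0; rewrite !scaleN1r !addr0 f0 addr0.
rewrite -lerN2 -fN; exact: le_trans (fp _) (cone_envelopeN p_sub Sp Sc).
Qed.

End hahn_banach.

(** * Lipschitz linear maps and Cauchy sequences *)

Section lcfun_lipschitz.
Context {R : realType} {E F : normedModType R}.

Lemma linear_lipschitz_lcfun (f : E -> F) (M : R) : linear f ->
  (forall x, `|f x| <= M * `|x|) -> f \in @lcfun R E F.
Proof.
move=> fl fM; apply/mem_set; split=> // x.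
have fB y : f x - f y = f (x - y).
  by have := fl (-1) y x; rewrite !scaleN1r addrC => <-; rewrite addrC.
apply/cvgrPdist_lt => e e0.
have M1 : 0 < `|M| + 1 by rewrite ltr_wpDl.
have : \forall y \near x, `|x - y| < e / (`|M| + 1).
  by apply: cvgr_dist_lt => //; rewrite divr_gt0.
apply: filterS => y; rewrite ltr_pdivlMr// fB => xy.
rewrite (le_lt_trans (fM _))// (le_lt_trans _ xy)// mulrC ler_wpM2l//.
by rewrite (le_trans (ler_norm M))// lerDl.
Qed.

End lcfun_lipschitz.

Lemma cauchy_rate_cvg (R : realType) (X : completeNormedModType R)
    (u : nat -> X) (e : nat -> R) : e n @[n --> \oo] --> 0 ->
  (forall n m, (n <= m)%N -> `|u n - u m| <= e n) -> cvgn u.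
Proof.
move=> e0 ue; apply/cauchy_cvgP/cauchy_exP => d d0.
have [N _ eN] : \forall n \near \oo, `|0 - e n| < d by exact: cvgr_dist_lt.
exists (u N); exists N => // n /= Nn; rewrite -ball_normE /=.
rewrite (le_lt_trans (ue _ _ Nn))// (le_lt_trans (ler_norm _))//.
by have := eN N (leqnn N); rewrite sub0r normrN.
Qed.

(** * The Bishop-Phelps theorem through Ekeland's variational principle *)

Section support_points.
Context {R : realType} {X : completeNormedModType R}.
Implicit Types (C : set X) (f : {lcfun X >-> R^o}).

(** Order [C] by putting [y] above [x] when the gain of [f] pays for [e] times the distance. A
    greedy sequence converges to a maximal element, which is the required point. *)
Lemma ekeland_linear C f (e : R) : C !=set0 -> closed C ->
    has_ubound (f @` C) -> 0 < e ->
  exists2 x0, C x0 & forall x, C x -> f x - f x0 <= e * `|x - x0|.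
Proof.
move=> [c0 Cc0] clC ubC e0.
pose S x := [set y | C y /\ e * `|y - x| <= f y - f x].
have Strans x y z : S x y -> S y z -> S x z.
  move=> [_ xy] [Cz yz]; split=> //.
  have := ler_wpM2l (ltW e0) (ler_distD y z x); rewrite mulrDr; lra.
(* The step nearly maximizes [f] over [S x]. The premise [C x] comes after the existential so that
   [choice] gives a total function. *)
have next (n : nat) x : exists y, C x ->
    S x y /\ forall z, S x z -> f z <= f y + n.+1%:R^-1.
  have [Cx|nCx] := pselect (C x); last by exists x.
  have supS : has_sup (f @` S x).
    split; first by exists (f x), x => //; split; rewrite // !subrr normr0 mulr0.
    by case: ubC => M CM; exists M => _ [y [Cy _] <-]; apply: CM; exists y.
  have n0 : 0 < n.+1%:R^-1 :> R by rewrite invr_gt0.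
  have [_ [y Sy <-] supy] := sup_adherent n0 supS.
  exists y => _; split=> // z Sz; rewrite -lerBlDr (le_trans _ (ltW supy))//.
  by rewrite lerB// sup_upper_bound//; exists z.
have {next}[F FS] := choice (fun nx => next nx.1 nx.2).
pose u := fix u n := if n is m.+1 then F (m, u m) else c0.
have Cu n : C (u n).
  by elim: n => //= n Cun; have [[]] := FS (n, u n) Cun.
have uS n : S (u n) (u n.+1) by have [] := FS (n, u n) (Cu n).
have umax n z : S (u n) z -> f z <= f (u n.+1) + n.+1%:R^-1.
  by have [_] := FS (n, u n) (Cu n); apply.
have uSm n m : (n <= m)%N -> S (u n) (u m).
  elim: m => [|m IH]; last rewrite leq_eqVlt => /predU1P[<-|/IH nm].
  - by rewrite leqn0 => /eqP->; split; rewrite // !subrr normr0 mulr0.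
  - by split; rewrite // !subrr normr0 mulr0.
  - exact: Strans nm (uS m).
have cvgu : cvgn u.
  have cvg_e : (e^-1 * n.+1%:R^-1 : R) @[n --> \oo] --> (0 : R).
    rewrite -[X in _ --> X](mulr0 e^-1); apply: cvgMr; exact: cvg_harmonic.
  (* Beyond [u n.+1] at most [n.+1%:R^-1] can still be gained, so the rate holds for the shifted
     sequence. *)
  suff : cvgn (fun n => u n.+1).
    by move=> /cvg_ex[l ul]; apply/cvg_ex; exists l; rewrite -cvg_shiftS.
  apply: (cauchy_rate_cvg cvg_e) => n m nm.
  have [_] := uSm n.+1 m.+1 nm; rewrite ler_pdivlMl// distrC => /le_trans; apply.
  by rewrite lerBlDl; apply: (umax); apply: (uSm); exact: leqW.
pose x0 := limn u.
have Cx0 : C x0 by apply: (closed_cvg C clC _ _ cvgu); exact: nearW.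
have Sx0 n : S (u n) x0.
  split=> //; apply: (ler_cvg_to (f := fun m => e * `|u m - u n|)
      (g := fun m => f (u m) - f (u n)) (a := \oo)).
  - by apply: cvgMr; apply: cvg_norm; apply: cvgB => //; exact: cvg_cst.
  - apply: cvgB; last exact: cvg_cst.
    by apply: continuous_cvg => //; exact: lcfun_continuous.
  - by exists n => // m /= nm; have [] := uSm n m nm.
(* A point violating the inequality would lie above [x0], hence above every [u n]; near-maximality
   then forces [f x <= f x0] in the limit, a contradiction. *)
exists x0 => // x Cx; rewrite leNgt; apply/negP => lt_x.
have Sx n : f x <= f x0 + n.+1%:R^-1.
  have /umax : S (u n) x by apply: Strans (Sx0 n) _; split=> //; exact: ltW.
  have [_] := Sx0 n.+1; have : 0 <= e * `|x0 - u n.+1| by rewrite mulr_ge0// ltW.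
  by move: (f x) (f x0) (f (u n.+1)) (_ * _) (_^-1) => a b c d k; lra.
have : f x <= f x0.
  apply: (ler_cvg_to (f := fun=> f x) (g := fun n => f x0 + n.+1%:R^-1) (a := \oo)).
  - exact: cvg_cst.
  - rewrite -[X in _ --> X]addr0; apply: cvgD; first exact: cvg_cst.
    exact: cvg_harmonic.
  - exact: nearW.
have : 0 <= e * `|x - x0| by rewrite mulr_ge0// ltW.
by move=> /le_lt_trans /(_ lt_x); rewrite subr_gt0 ltNge => /negP.
Qed.

End support_points.

(** Convexity with unnormalized weights, the form needed for sums in a generated cone. *)
Lemma convex_setP (R : realType) (V : lmodType R) (C : set V) x y (s t : R) :
  convex_set C -> C x -> C y -> 0 <= s -> 0 <= t -> 0 < s + t ->
  C ((s + t)^-1 *: (s *: x + t *: y)).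
Proof.
move=> cvC Cx Cy s0 t0 st0; pose l := s / (s + t).
have l0 : 0 <= l by rewrite divr_ge0// ltW.
have l1 : l <= 1 by rewrite ler_pdivrMr// mul1r lerDl.
have := cvC x y (Itv01 l0 l1) (mem_set Cx) (mem_set Cy); rewrite inE.
have -> : conv (Itv01 l0 l1) (x : convex_lmodType V) y = l *: x + (1 - l) *: y by [].
suff -> : (s + t)^-1 *: (s *: x + t *: y) = l *: x + (1 - l) *: y by [].
have -> : 1 - l = (s + t)^-1 * t by rewrite /l; field; rewrite gt_eqF.
by rewrite scalerDr !scalerA /l mulrC.
Qed.

Section bishop_phelps.
Context {R : realType} {X : completeNormedModType R}.

Lemma bounded_set_ubound (C : set X) (f : {lcfun X >-> R^o}) :
  bounded_set C -> has_ubound (f @` C).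
Proof.
move=> [M [_ CM]]; exists (`|f| * (`|M| + 1)) => _ [x Cx <-].
rewrite (le_trans (ler_norm _))// (le_trans (opnorm_le f x))//.
rewrite ler_wpM2l ?opnorm_ge0//; apply: (CM (`|M| + 1) _ x Cx).
by rewrite (le_lt_trans (ler_norm M))// ltrDl.
Qed.

(** Ekeland's inequality at [x0] says that the cone generated by the pairs [(x - x0, f x - f x0)] is
    dominated by [e] times the norm. Hahn-Banach gives [phi] of norm at most [e] that grows from
    [x0] at least as much as [f] does on [C], so [f - phi] is maximal on [C] at [x0]. *)
Lemma bishop_phelps (C : set X) (f : {lcfun X >-> R^o}) (e : R) :
  C !=set0 -> convex_set C -> closed C -> bounded_set C -> 0 < e ->
  exists psi : {lcfun X >-> R^o},
    (forall v, `|psi v - f v| <= e * `|v|) /\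
    exists2 x0, C x0 & forall x, C x -> psi x <= psi x0.
Proof.
move=> C0 cvC clC bC e0.
have [x0 Cx0 fx0] := ekeland_linear C0 clC (bounded_set_ubound f bC) e0.
pose p (v : X) := e * `|v|.
pose S := [set c | exists t x, [/\ 0 <= t :> R, C x &
  c = (t *: (x - x0), t * (f x - f x0))]].
have p_sub : sublinear p.
  split=> [x y|t x t0]; first by rewrite /p -mulrDr ler_wpM2l ?ler_normD// ltW.
  by rewrite /p normrZ ger0_norm// mulrCA.
have S0 : S (0, 0) by exists 0, x0; split=> //; rewrite scale0r mul0r.
have SD c d : S c -> S d -> S (c + d).
  move=> [s [x [s0 Cx ->]]] [t [y [t0 Cy ->]]].
  have := addr_ge0 s0 t0; rewrite le_eqVlt => /predU1P[st|st].
    (* With total weight zero there is no barycentre, and [x0] stands in for it. *)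
    have [-> ->] : s = 0 /\ t = 0 by lra.
    by exists 0, x0; rewrite !scale0r !mul0r; split=> //; congr pair; rewrite /= addr0.
  exists (s + t), ((s + t)^-1 *: (s *: x + t *: y)); split; [exact: ltW|exact: convex_setP|].
  have st0 : s + t != 0 by rewrite gt_eqF.
  congr pair => /=.
    by rewrite [RHS]scalerBr scalerA divff// scale1r !scalerBr scalerDl opprD addrACA.
  rewrite linearZ linearD !linearZ /= -[LHS]/(s * (f x - f x0) + t * (f y - f x0)).
  rewrite [RHS]mulrBr -[_ *: (_ + _)]/((s + t)^-1 * (s * f x + t * f y)).
  by rewrite mulrA divff// mul1r; ring.
have SZ (t : R) c : 0 <= t -> S c -> S (t *: c).
  move=> t0 [s [x [s0 Cx ->]]]; exists (t * s), x; split=> //; first exact: mulr_ge0.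
  by rewrite -scalerA -mulrA.
have Sp c : S c -> c.2 <= p c.1.
  move=> [t [x [t0 Cx ->]]] /=; rewrite /p normrZ ger0_norm// mulrCA.
  by rewrite ler_wpM2l// fx0.
have [phi [phil phip Sphi]] := hahn_banach_cone p_sub S0 SD SZ Sp.
have phiN v : phi (- v) = - phi v.
  have phi0 : phi 0 = 0 by have := phil (-1) 0 0; rewrite scaler0 addr0 scaleN1r addNr.
  by have := phil (-1) v 0; rewrite !scaleN1r !addr0 phi0 addr0.
have phi_le v : `|phi v| <= e * `|v|.
  by rewrite ler_norml phip andbT lerNl -phiN (le_trans (phip _))// /p normrN.
pose phi' := lcfun_Sub (linear_lipschitz_lcfun phil phi_le).
exists (f - phi'); split=> [v|].
  have -> : (f - phi') v = f v - phi v by [].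
  by rewrite addrAC subrr add0r normrN.
exists x0 => // x Cx.
rewrite -[(f - phi') x]/(f x - phi x) -[(f - phi') x0]/(f x0 - phi x0).
have /Sphi /= : S (x - x0, f x - f x0).
  by exists 1, x; split=> //; rewrite scale1r mul1r.
have -> : phi (x - x0) = phi x - phi x0.
  by have := phil 1 x (- x0); rewrite !scale1r phiN.
by move: (f x) (f x0) (phi x) (phi x0) => a b c d; lra.
Qed.

End bishop_phelps.

(** * Midpoint hull of the group and contraction of orbit diameters *)

Definition midpoint_closed (R : realType) (V : lmodType R) (K : set V) :=
  forall x y, K x -> K y -> K (2^-1 *: (x + y)).

Lemma midpointxx (R : realType) (V : lmodType R) (x : V) : 2^-1 *: (x + x) = x.
Proof. by rewrite -(mulr2n x) -(scaler_nat 2 x) scalerA mulVf ?scale1r. Qed.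

Section averaging.
Context {R : realType} {X : normedModType R} (G : set {lcfun X >-> X}).
Hypotheses (G_group : operator_group G) (G_iso : isometries G).
Implicit Types (g h : {lcfun X >-> X}) (A B p : X -> X).

Let G1 : G [lcfun of @idfun X]. Proof. by have [] := G_group. Qed.

Let GM g h : G g -> G h -> exists2 k, G k & k =1 g \o h.
Proof.
by have [_ GM _] := G_group; move=> Gg Gh; exists [lcfun of g \o h]; [exact: GM|].
Qed.

Let GV g : G g -> exists2 h, G h & cancel g h /\ cancel h g.
Proof.
have [_ _ GV] := G_group; move=> /GV[h [Gh gh hg]]; exists h => //.
by split=> x; [have := congr1 (fun k : {lcfun X >-> X} => k x) hg
  |have := congr1 (fun k : {lcfun X >-> X} => k x) gh].
Qed.

Lemma isometry_norm g x : G g -> `|g x| = `|x|.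
Proof. by move=> Gg; rewrite -[g x]subr0 -(linear0 g) G_iso// subr0. Qed.

(** Impredicative, so that membership is itself an induction principle with a binary, weight-free
    step. Members are bare functions; linearity and contractivity are recovered by that
    induction. *)
Definition midpoint_hull : set (X -> X) :=
  [set A | forall K : set (X -> X), midpoint_closed K ->
    (forall g, G g -> K g) -> K A].

Local Notation H := midpoint_hull.

Lemma midpoint_hull_closed : midpoint_closed H.
Proof. by move=> A B HA HB K Kmid KG; apply: (Kmid); [exact: HA|exact: HB]. Qed.

Lemma midpoint_hullG g : G g -> H g.
Proof. by move=> Gg K _; exact. Qed.

Let midE A B x : (2^-1 *: (A + B)) x = 2^-1 *: (A x + B x). Proof. by []. Qed.

Lemma midpoint_hullJ A g h : G g -> G h -> H A -> H (g \o A \o h).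
Proof.
move=> Gg Gh HA; pose K := [set B : X -> X | H (g \o B \o h)]; suff: K A by [].
apply: HA => [B C HB HC|k Gk]; rewrite /K /=.
  suff -> : g \o (2^-1 *: (B + C)) \o h = 2^-1 *: ((g \o B \o h) + (g \o C \o h)).
    exact: midpoint_hull_closed.
  by apply/funext => x /=; rewrite midE linearZ linearD.
have [l Gl lE] := GM Gg Gk; have [m Gm mE] := GM Gl Gh.
suff -> : g \o k \o h = m by exact: midpoint_hullG.
by apply/funext => x; rewrite mE /= lE.
Qed.

Lemma midpoint_hull_linear A : H A -> linear A.
Proof.
move=> HA; pose K := [set B : X -> X | linear B]; suff: K A by [].
apply: HA => [B C lB lC|g _]; last exact: linearP.
move=> t x y.
by rewrite !midE lB lC addrACA -(scalerDr t) [LHS]scalerDr !scalerA mulrC.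
Qed.

Lemma midpoint_norm (x y : X) (a b : R) : `|x| <= a -> `|y| <= b ->
  `|2^-1 *: (x + y)| <= (a + b) / 2.
Proof.
move=> xa yb; rewrite normrZ ger0_norm ?invr_ge0// mulrC ler_wpM2r ?invr_ge0//.
by rewrite (le_trans (ler_normD _ _))// lerD.
Qed.

Lemma midpoint_distl (x y z : X) (a b : R) : `|x - y| <= a -> `|x - z| <= b ->
  `|x - 2^-1 *: (y + z)| <= (a + b) / 2.
Proof.
move=> xy xz; have -> : x - 2^-1 *: (y + z) = 2^-1 *: ((x - y) + (x - z)).
  by rewrite addrACA -opprD scalerBr midpointxx.
exact: midpoint_norm.
Qed.

Lemma midpoint_distr (x y z : X) (a : R) : `|y - x| <= a -> `|z - x| <= a ->
  `|2^-1 *: (y + z) - x| <= a.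
Proof.
rewrite !(distrC _ x) => xy xz; apply: le_trans (midpoint_distl xy xz) _.
by rewrite mulrDl -splitr.
Qed.

Lemma midpoint_hull_norm A x : H A -> `|A x| <= `|x|.
Proof.
move=> HA; pose K := [set A : X -> X | `|A x| <= `|x|]; suff: K A by [].
apply: HA => [B C Bx Cx|g Gg]; rewrite /K /=.
  by have := midpoint_norm Bx Cx; rewrite -midE; lra.
by rewrite isometry_norm.
Qed.

(** Diameter of the two-sided orbit in operator norm, spelled out pointwise because [A] is a bare
    function. *)
Definition orbit_diam_le A (D : R) := forall g h g' h' x,
  G g -> G h -> G g' -> G h' -> `|g (A (h x)) - g' (A (h' x))| <= D * `|x|.

(* Successive midpoints with finitely many orbit points: each of these pulls
   the point strictly inside the ball of radius [D] about any orbit point close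
   to it. *)
Lemma iterated_midpoint A (D : R) (s : seq ({lcfun X >-> X} * {lcfun X >-> X})) :
  (forall k, k \in s -> G k.1 /\ G k.2) -> 0 <= D ->
  exists B, (forall K, midpoint_closed K ->
      (forall g h, G g -> G h -> K (g \o A \o h)) -> K B) /\
    forall p, (forall g h x, G g -> G h -> `|p x - g (A (h x))| <= D * `|x|) ->
    (forall x, `|p x - B x| <= D * `|x|) /\
    ((exists2 k, k \in s & forall x, `|p x - k.1 (A (k.2 x))| <= D / 2 * `|x|) ->
     forall x, `|p x - B x| <= D * (1 - 2^-1 ^+ (size s).+1) * `|x|).
Proof.
move=> sG D0; elim: s sG => [_|k s IH sG].
  exists A; split=> [K _ KG|p pA]; first exact: (KG _ _ G1 G1).
  by split=> [x|[]]//; exact: (pA _ _ x G1 G1).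
have [|B [BK BA]] := IH; first by move=> l ls; apply: sG; rewrite inE ls orbT.
have [Gk1 Gk2] := sG k (mem_head _ _).
exists (2^-1 *: (B + (k.1 \o A \o k.2))); split=> [K Kmid KG|p pA].
  by apply: (Kmid); [exact: BK|exact: KG].
have [pB pBs] := BA p pA.
split=> [x|[l] ]; first rewrite midE.
  apply: le_trans (midpoint_distl (pB x) (pA _ _ x Gk1 Gk2)) _.
  by rewrite le_eqVlt; apply/orP; left; apply/eqP; field.
have q1 : 2^-1 ^+ (size s).+1 <= 2^-1 :> R.
  by rewrite exprS ler_piMr ?invr_ge0// exprn_ile1 ?invr_ge0// invf_le1// ler1n.
(* If the close orbit point is the new one, the bound is [3 D / 4], which suffices as the exponent
   is at least 2. Otherwise averaging with a point within [D] keeps half of the gain already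
   made. *)
rewrite inE => /predU1P[->|ls] pl x; rewrite midE /= [2^-1 ^+ _.+2]exprS.
  apply: le_trans (midpoint_distl (pB x) (pl x)) _.
  have : 0 <= D * `|x| * (2^-1 - 2^-1 ^+ (size s).+1).
    by rewrite mulr_ge0 ?subr_ge0// mulr_ge0.
  lra.
have pBx : `|p x - B x| <= D * (1 - 2^-1 ^+ (size s).+1) * `|x|.
  by apply: pBs; exists l.
apply: le_trans (midpoint_distl pBx (pA _ _ x Gk1 Gk2)) _.
lra.
Qed.

(** As [s] indexes a [D / 2]-net of the orbit of [A], the iterated midpoint [B] is strictly closer
    than [D] to the whole orbit when [D > 0]. Since [B] lies in the midpoint hull of that orbit, the
    bound passes to the orbit of [B]. *)
Lemma orbit_diam_contract A (D : R) (s : seq ({lcfun X >-> X} * {lcfun X >-> X})) :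
  (forall k, k \in s -> G k.1 /\ G k.2) -> 0 <= D -> H A ->
  orbit_diam_le A D ->
  (forall g h, G g -> G h -> exists2 k, k \in s &
    forall x, `|g (A (h x)) - k.1 (A (k.2 x))| <= D / 2 * `|x|) ->
  exists2 B, H B & orbit_diam_le B (D * (1 - 2^-1 ^+ (size s).+1)).
Proof.
move=> sG D0 HA AD As; have [B [BK Bp]] := iterated_midpoint A sG D0.
set D' := D * (1 - _) in Bp *.
exists B.
  apply: BK => [|g h Gg Gh]; first exact: midpoint_hull_closed.
  exact: midpoint_hullJ.
have BD g h x : G g -> G h -> `|g (A (h x)) - B x| <= D' * `|x|.
  move=> Gg Gh; have [|_] := Bp (g \o A \o h).
    by move=> a b y Ga Gb; exact: AD.
  by move=> /(_ (As g h Gg Gh) x).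
move=> g h g' h' x Gg Gh Gg' Gh'.
(* One occurrence of [B] stays fixed while the other is built up from orbit points of [A]; balls are
   midpoint closed. *)
pose K := [set C : X -> X | `|g (C (h x)) - g' (B (h' x))| <= D' * `|x|].
suff: K B by [].
apply: BK => [C1 C2 KC1 KC2|a b Ga Gb]; rewrite /K /=.
  rewrite midE linearZ linearD.
  exact: midpoint_distr KC1 KC2.
(* Cancelling the isometries [g'] and [h'] reduces the comparison to [BD]. *)
have [k Gk [gk kg]] := GV Gg'; have [l Gl [hl lh]] := GV Gh'.
have [c Gc cE] := GM Gk Gg; have [c' Gc' c'E] := GM Gc Ga.
have [d Gd dE] := GM Gb Gh; have [d' Gd' d'E] := GM Gd Gl.
have := BD c' d' (h' x) Gc' Gd'; rewrite isometry_norm//.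
rewrite -(G_iso Gg') c'E /= cE /= kg d'E /= hl dE /=; exact.
Qed.

Lemma compact_finite_net (e : R) : compact G -> 0 < e ->
  exists s : seq {lcfun X >-> X}, (forall g, g \in s -> G g) /\
    forall g, G g -> exists2 k, k \in s & forall x, `|g x - k x| <= e * `|x|.
Proof.
rewrite compact_cover => cG e0.
have [|g Gg|F FG GF] := cG _ G (fun g => ball g e).
- by move=> g _; exact: ball_open.
- by exists g => //; exact: ballxx.
exists (finmap.enum_fset F); split=> [g /FG|g /GF[k kF]]; first by rewrite inE.
rewrite -ball_normE /= => kg; exists k => // x.
have -> : g x - k x = (g - k) x by [].
rewrite (le_trans (opnorm_le _ x))// ler_wpM2r// -lcfun_normE distrC.
exact: ltW.
Qed.

(** Contraction is iterated from the identity, whose orbit has diameter at most 2. The ratio [q] is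
    the same at every stage: hull elements are linear and contractive, so one finite net of [G]
    serves for all their orbits. *)
Lemma exists_small_orbit_diam (e : R) : compact G -> 0 < e ->
  exists2 A, H A & orbit_diam_le A e.
Proof.
move=> cG e0; have e8 : 0 < e / 8 by rewrite divr_gt0.
have [s [sG Gs]] := compact_finite_net cG e8.
pose s2 := [seq (a, b) | a <- s, b <- s].
pose q : R := 1 - 2^-1 ^+ (size s2).+1.
have s2G k : k \in s2 -> G k.1 /\ G k.2.
  by move=> /allpairsP[[a b] [/= sa sb ->]]; split; exact: sG.
have p0 : 0 < 2^-1 ^+ (size s2).+1 :> R by rewrite exprn_gt0// invr_gt0.
have p1 : 2^-1 ^+ (size s2).+1 <= 1 :> R.
  by rewrite exprn_ile1 ?invr_ge0// invf_le1// ler1n.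
have q0 : 0 <= q by rewrite subr_ge0.
have q1 : q < 1 by rewrite ltrBlDr ltrDl.
(* The net resolves orbits only up to [e / 8 + e / 8 = e / 4]. This is at most half of the diameter
   bound because of the constant summand [e / 2]. *)
have step n : exists2 A, H A & orbit_diam_le A (e / 2 + 2 * q ^+ n).
  elim: n => [|n [A HA AD]].
    exists idfun; first exact: midpoint_hullG G1.
    move=> g h g' h' x Gg Gh Gg' Gh' /=; rewrite expr0.
    rewrite (le_trans (ler_normB _ _))// !isometry_norm// mulr1.
    have : 0 <= e / 2 * `|x| by rewrite mulr_ge0// divr_ge0// ltW.
    lra.
  have qn0 : 0 <= q ^+ n by exact: exprn_ge0.
  have D0 : 0 <= e / 2 + 2 * q ^+ n.
    by rewrite addr_ge0 ?divr_ge0 ?(ltW e0)// mulr_ge0// exprn_ge0.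
  have [g h Gg Gh|B HB BD] := orbit_diam_contract s2G D0 HA AD.
    have [a sa ga] := Gs g Gg; have [b sb hb] := Gs h Gh.
    exists (a, b) => [|x /=]; first by apply/allpairsP; exists (a, b).
    have AB y z : A y - A z = A (y - z).
      have := midpoint_hull_linear HA (-1) z y; rewrite !scaleN1r addrC => <-.
      by rewrite addrC.
    have -> : g (A (h x)) - a (A (b x)) =
        (g (A (h x)) - a (A (h x))) + a (A (h x - b x)).
      by rewrite -AB linearB addrA subrK.
    have := le_trans (midpoint_hull_norm _ HA) (hb x).
    rewrite -(isometry_norm (A (h x - b x)) (sG _ sa)) => aAhb.
    have := ga (A (h x)); have := midpoint_hull_norm (h x) HA.
    rewrite [X in _ <= X]isometry_norm// => Ahx gaAh.
    have := le_trans gaAh (ler_wpM2l (ltW e8) Ahx) => {}gaAh.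
    rewrite (le_trans (ler_normD _ _))// (le_trans (lerD gaAh aAhb))//.
    rewrite -mulrDl ler_wpM2r//; lra.
  exists B => // g h g' h' x Gg Gh Gg' Gh'.
  rewrite (le_trans (BD g h g' h' x Gg Gh Gg' Gh'))// ler_wpM2r//.
  rewrite -/q exprS mulrDl; have : e / 2 * q <= e / 2.
    by rewrite ler_piMr ?ltW// divr_gt0.
  by rewrite -mulrA (mulrC q); lra.
have [n qn] : exists n, q ^+ n <= e / 4.
  have : q ^+ n @[n --> \oo] --> (0 : R) by apply: cvg_expr; rewrite ger0_norm.
  move=> /cvgrPdist_le /(_ (e / 4)); rewrite divr_gt0// => /(_ isT)[N _ qN].
  exists N; have := qN N (leqnn N).
  by rewrite /= sub0r normrN ger0_norm// exprn_ge0.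
have [A HA AD] := step n; exists A => // g h g' h' x Gg Gh Gg' Gh'.
rewrite (le_trans (AD g h g' h' x Gg Gh Gg' Gh'))// ler_wpM2r//; lra.
Qed.

End averaging.

(** * The averaging projection *)

Section averaging_projection.
Context {R : realType} {X : completeNormedModType R} (G : set {lcfun X >-> X}).

Lemma harmonic_dist_cvg_eq (u v : nat -> X) (l m : X) (c : R) :
  u n @[n --> \oo] --> l -> v n @[n --> \oo] --> m ->
  (forall n, `|u n - v n| <= n.+1%:R^-1 * c) -> l = m.
Proof.
move=> ul vm uv; apply/eqP; rewrite -subr_eq0 -normr_le0.
apply: (ler_cvg_to (f := fun n => `|u n - v n|)
  (g := fun n => n.+1%:R^-1 * c) (a := \oo)).
- by apply: cvg_norm; exact: cvgB.
- rewrite -[X in _ --> X](mul0r c); apply: cvgMl; exact: cvg_harmonic.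
- exact: nearW.
Qed.

(** The last clause is the source of the further properties of [P]: it gets applied to [C], to the
    singleton of a fixed point, to a ball and to a level set of an invariant functional. *)
Lemma averaging_projection : operator_group G -> isometries G -> compact G ->
  exists P : {lcfun X >-> X}, [/\
    forall g x, G g -> g (P x) = P x, forall g x, G g -> P (g x) = P x &
    forall (K : set X) x, closed K -> midpoint_closed K ->
      (forall g y, G g -> K y -> K (g y)) -> K x -> K (P x)].
Proof.
move=> Ggrp Giso cG; have G1 : G [lcfun of @idfun X] by have [] := Ggrp.
have inv0 n : 0 < n.+1%:R^-1 :> R by rewrite invr_gt0.
have ex n : exists A, midpoint_hull G A /\ orbit_diam_le G A n.+1%:R^-1.
  by have [A HA AD] := exists_small_orbit_diam Ggrp Giso cG (inv0 n); exists A.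
have {ex}[A HA] := choice ex.
have AL n g x : G g -> `|g (A n x) - A n x| <= n.+1%:R^-1 * `|x|.
  by move=> Gg; apply: ((HA n).2 _ _ _ _ x Gg G1 G1 G1).
have AR n g x : G g -> `|A n (g x) - A n x| <= n.+1%:R^-1 * `|x|.
  by move=> Gg; apply: ((HA n).2 _ _ _ _ x G1 Gg G1 G1).
have Alin n : linear (A n) by exact: midpoint_hull_linear (HA n).1.
(* Induction on [A n] in the hull: the ball about [A m x] contains every [g (A m x)] by [AL]. For
   [AAR] the induction is on [A m]. *)
have AAL n m x : `|A n (A m x) - A m x| <= m.+1%:R^-1 * `|x|.
  pose K := [set B : X -> X | `|B (A m x) - A m x| <= m.+1%:R^-1 * `|x|].
  suff: K (A n) by [].
  apply: (HA n).1 => [B C KB KC|g Gg]; last exact: AL.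
  exact: midpoint_distr KB KC.
have AAR n m x : `|A n (A m x) - A n x| <= n.+1%:R^-1 * `|x|.
  pose K := [set B : X -> X | `|A n (B x) - A n x| <= n.+1%:R^-1 * `|x|].
  suff: K (A m) by [].
  apply: (HA m).1 => [B C KB KC|g Gg]; last exact: AR.
  have A0 : A n 0 = 0.
    by have := Alin n (-1) 0 0; rewrite scaler0 addr0 scaleN1r addNr.
  have AD y z : A n (y + z) = A n y + A n z.
    by have := Alin n 1 y z; rewrite !scale1r.
  have AZ t y : A n (t *: y) = t *: A n y.
    by have := Alin n t y 0; rewrite A0 !addr0.
  rewrite /K /= -[(_ *: _) x]/(2^-1 *: (B x + C x)) AZ AD.
  exact: midpoint_distr KB KC.
(* [A n \o A m] is close both to [A n] and to [A m]. *)
have cvgA x : cvgn (fun n => A n x).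
  apply: (cauchy_rate_cvg (e := fun n => n.+1%:R^-1 * (2 * `|x|))) => [|n m nm].
    rewrite -[X in _ --> X](mul0r (2 * `|x|)); apply: cvgMl; exact: cvg_harmonic.
  apply: le_trans (ler_distD (A n (A m x)) _ _) _; rewrite (distrC (A n x)).
  apply: le_trans (lerD (AAR n m x) (AAL n m x)) _.
  rewrite mulrA -mulrDl ler_wpM2r// mulr_natr mulr2n lerD2l.
  by rewrite lef_pV2 ?posrE ?ltr0n// ler_nat ltnS.
pose P x := limn (fun n => A n x).
have Plin : linear P.
  move=> t x y; apply: (@cvg_unique _ (@norm_hausdorff _ X) (A n (t *: x + y) @[n --> \oo])).
    exact: cvgA.
  have -> : (fun n => A n (t *: x + y)) = (fun n => t *: A n x + A n y).
    by apply/funext => n; exact: Alin.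
  by apply: cvgD; [apply: cvgZr; exact: cvgA|exact: cvgA].
have PK (K : set X) x : closed K -> midpoint_closed K ->
    (forall g y, G g -> K y -> K (g y)) -> K x -> K (P x).
  move=> clK Kmid KG Kx; apply: (closed_cvg K clK _ _ (cvgA x)).
  apply: nearW => n; pose L := [set B : X -> X | K (B x)]; suff: L (A n) by [].
  by apply: (HA n).1 => [B C KB KC|g Gg]; [exact: Kmid|exact: KG].
have P1 x : `|P x| <= 1 * `|x|.
  rewrite mul1r; apply: (ler_cvg_to (f := fun n => `|A n x|) (a := \oo)).
  - by apply: cvg_norm; exact: cvgA.
  - exact: cvg_cst.
  - by apply: nearW => n; exact: midpoint_hull_norm (HA n).1.
exists (lcfun_Sub (linear_lipschitz_lcfun Plin P1)).
split=> [g x Gg|g x Gg|] //=.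
- apply: (harmonic_dist_cvg_eq (u := fun n => g (A n x)) (v := fun n => A n x) (c := `|x|)).
  + by apply: continuous_cvg; [exact: lcfun_continuous|exact: cvgA].
  + exact: cvgA.
  + by move=> n; exact: AL.
- apply: (harmonic_dist_cvg_eq (u := fun n => A n (g x)) (v := fun n => A n x) (c := `|x|)).
  + exact: cvgA.
  + exact: cvgA.
  + by move=> n; exact: AR.
Qed.

End averaging_projection.

(** * Transfer from the fixed points to the invariant dual *)

Lemma normed_closed1 (R : realType) (X : normedModType R) (x : X) :
  closed [set x].
Proof. exact/accessible_closed_set1/hausdorff_accessible/norm_hausdorff. Qed.

Lemma attains_maxP (R : realType) (X : normedModType R) (C : set X)
    (h : {lcfun X >-> R^o}) x0 :
  C x0 -> (forall x, C x -> h x <= h x0) -> attains_max C h.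
Proof.
move=> Cx0 hx0; exists x0 => //; apply/eqP; rewrite eq_le; apply/andP; split.
  apply: ub_le_sup; last by exists x0.
  by exists (h x0) => _ [x Cx <-]; exact: hx0.
by apply: ge_sup; [exists (h x0), x0|move=> _ [x Cx <-]; exact: hx0].
Qed.

Theorem theorem21 (R : realType) (X : completeNormedModType R)
    (G : set {lcfun X >-> X}) (C : set X) :
  operator_group G -> compact G -> isometries G ->
  C !=set0 -> convex_set C -> closed C -> bounded_set C ->
  invariant_set G C ->
  dense [set h : invariant_dual G | attains_max C (\val h)].
Proof.
move=> Ggrp cG Giso [c Cc] cvC clC bC CG.
have [P [gP Pg PK]] := averaging_projection Ggrp Giso cG.
have midC : midpoint_closed C.
  move=> x y Cx Cy.
  have -> : 2^-1 *: (x + y) = (1 + 1)^-1 *: (1 *: x + 1 *: y) by rewrite !scale1r.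
  by apply: convex_setP => //; rewrite ?ler01// ltr_wpDl.
have PC x : C x -> C (P x).
  by apply: PK => // g y Gg Cy; rewrite -(CG _ Gg); exists y.
have Pfix x : (forall g, G g -> g x = x) -> P x = x.
  move=> gx; apply: (PK [set x]) => //=.
  - exact: normed_closed1.
  - by move=> _ _ -> ->; exact: midpointxx.
  - by move=> g _ Gg ->; exact: gx.
have PP x : P (P x) = P x by apply: Pfix => g Gg; exact: gP.
have Pnorm x : `|P x| <= `|x|.
  apply: (PK [set y | `|y| <= `|x|]) => //=.
  - have := @closed_closed_ball_ R X 0 `|x|; congr closed.
    by apply/seteqP; split=> y; rewrite /closed_ball_ /= sub0r normrN.
  - move=> y z yx zx; apply: le_trans (midpoint_norm yx zx) _.
    by rewrite mulrDl -splitr.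
  - by move=> g y Gg yx; rewrite (isometry_norm Giso).
(* By [gP] and [Pfix] the fixed points of [P] are those of [G]; the equation in [P] makes convexity
   and closedness immediate. *)
pose C' := [set x | C x /\ P x = x].
have C'0 : C' !=set0 by exists (P c); split; [exact: PC|exact: PP].
have cvC' : convex_set C'.
  move=> x y l; rewrite !inE => -[Cx Px] [Cy Py]; split.
    by have := cvC x y l (mem_set Cx) (mem_set Cy); rewrite inE.
  have -> : conv l (x : convex_lmodType X) y = l%:num *: x + (1 - l%:num) *: y by [].
  by rewrite linearD !linearZ /= Px Py.
have clC' : closed C'.
  have -> : C' = C `&` (fun x => P x - x) @^-1` [set 0].
    apply/seteqP; split=> x [Cx] /= => [->|/eqP]; first by rewrite subrr.
    by rewrite subr_eq0 => /eqP.
  apply: closedI => //.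
  apply: closed_comp => [x _|]; last exact: normed_closed1.
  by apply: cvgB; [exact: lcfun_continuous|exact: cvg_id].
have bC' : bounded_set C'.
  case: bC => M [Mr CM]; exists M; split=> // N MN x [Cx _]; exact: CM.
(* The subtype carries the induced topology, so the open set [O] is the preimage of an open [V] of
   the dual. *)
move=> O [f Of] [V oV VO].
have fG : invariant_dual G (\val f) by exact: set_mem (valP f).
have fP x : \val f (P x) = \val f x.
  apply: (PK [set y | \val f y = \val f x]) => //=.
  - have -> : [set y | \val f y = \val f x] = \val f @^-1` [set \val f x] by [].
    apply: closed_comp => [y _|]; last exact: normed_closed1.
    exact: lcfun_continuous.
  - move=> y z yx zx; rewrite /= linearZ linearD /= yx zx.
    exact: midpointxx.
  - by move=> g y Gg; rewrite fG.
have Vf : V (\val f) by move: Of; rewrite -VO.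
have /nbhs_ballP[r /= r0 rV] := open_nbhs_nbhs (conj oV Vf).
(* Half the radius, since the estimate on [psi] is not strict while the ball is open. *)
have r2 : 0 < r / 2 by rewrite divr_gt0.
have [psi [psi_f [x0 [Cx0 Px0] psi_x0]]] :=
  bishop_phelps (\val f) C'0 cvC' clC' bC' r2.
pose h : {lcfun X >-> R^o} := [lcfun of psi \o P].
have hG : h \in invariant_dual G by apply/mem_set => g x Gg; rewrite /h /= Pg.
exists (exist _ h hG); split.
  rewrite -VO; apply: rV; rewrite -ball_normE /=.
  have : `|\val f - h| <= r / 2.
    apply: opnorm_lub => [|x]; first exact: ltW.
    (* As [f \o P = f], the difference is [(f - psi) \o P], and [P] is contractive. *)
    have -> : (\val f - h) x = \val f (P x) - psi (P x) by rewrite fP.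
    by rewrite distrC (le_trans (psi_f _))// ler_wpM2l// ltW.
  by move=> /le_lt_trans; apply; rewrite ltr_pdivrMr// ltr_pMr// ltr1n.
apply: (attains_maxP Cx0) => x Cx /=; rewrite Px0.
by apply: psi_x0; split; [exact: PC|exact: PP].
Qed.
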